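(* Let $\alpha,\beta,\gamma,\delta\in\mathbb{R}$ with $\alpha\neq 0$ and $\delta\neq 0$, and consider the difference equation on $\mathbb{R}$ $$(\mathrm{L})\qquad y_{n+1}=\alpha|y_n|+\beta y_n+\gamma y_{n-1}+\delta .$$ Let $q\in\mathbb{R}\setminus\{0\}$ and let $A$ be such that either $A>1$ and $\frac{\alpha}{q}>0$, or $0<A<1$ and $\frac{\alpha}{q}<0$. Then (L) is topologically conjugate to the difference equation on $(0,\infty)$ $$z_{n+1}=\frac{\max\{z_n^{2\alpha},A^{\frac{-2\alpha p}{q}}\}}{z_n^{\alpha-\beta}\cdot z_{n-1}^{-\gamma}}\cdot A^{\frac{p(\alpha+\beta+\gamma-1)+\delta}{q}}$$ for all $p\in\mathbb{R}$. In particular, if $\alpha+\beta+\gamma-1\neq 0$, then (L) is topologically conjugate to: - $z_{n+1}=\frac{\max\{z_n^{2\alpha},B\}}{z_n^{\alpha-\beta}\cdot z_{n-1}^{-\gamma}}$ for all $B>1$, if $\frac{\delta}{\alpha+\beta+\gamma-1}>0$; - $z_{n+1}=\frac{\max\{z_n^{2\alpha},C\}}{z_n^{\alpha-\beta}\cdot z_{n-1}^{-\gamma}}$ for all $0<C<1$, if $\frac{\delta}{\alpha+\beta+\gamma-1}<0$. Moreover, if $\alpha+\beta+\gamma-1=0$, then (L) is topologically conjugate to: - $z_{n+1}=\frac{\max\{z_n^{2\alpha},1\}}{z_n^{\alpha-\beta}\cdot z_{n-1}^{-\gamma}}\cdot B$ for all $B>1$, if $\frac{\delta}{\alpha}>0$;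 - $z_{n+1}=\frac{\max\{z_n^{2\alpha},1\}}{z_n^{\alpha-\beta}\cdot z_{n-1}^{-\gamma}}\cdot C$ for all $0<C<1$, if $\frac{\delta}{\alpha}<0$.
   Context: To a second-order difference equation $x_{n+1}=f(x_n,x_{n-1})$ on a topological space $X$ one associates the discrete dynamical system $(X^2,F)$ with $F(x,y)=(y,f(y,x))$. Two continuous maps $\varphi:X\to X$ and $\psi:Y\to Y$ are topologically conjugate if there is a homeomorphism $\phi:X\to Y$ with $\phi\circ\varphi=\psi\circ\phi$. Two difference equations are topologically conjugate if their associated dynamical systems are. Here the equation in $y_n$ is considered with arbitrary real initial conditions ($X=\mathbb{R}$), and the equations in $z_n$ with arbitrary positive initial conditions ($X=(0,\infty)$). *)

(* Defs.v *)
From HB Require Import structures.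
From mathcomp Require Import all_boot all_order all_algebra.
From mathcomp Require Import all_classical all_reals all_analysis.

Set Implicit Arguments.
Unset Strict Implicit.
Unset Printing Implicit Defensive.

Import Order.TTheory GRing.Theory Num.Theory.
Import numFieldNormedType.Exports.

Local Open Scope classical_set_scope.
Local Open Scope ring_scope.

Definition homeomorphism (X Y : topologicalType) (h : X -> Y) : Prop :=
  continuous h /\
  exists g : Y -> X, [/\ cancel h g, cancel g h & continuous g].

Definition topologically_conjugate (X Y : topologicalType)
    (phi : X -> X) (psi : Y -> Y) : Prop :=
  [/\ continuous phi, continuous psi &
      exists h : X -> Y, homeomorphism h /\ h \o phi = psi \o h].

(* The second-order equation x_{n+1} = f(x_n, x_{n-1}) is represented by f;
   the state of its associated system is the pair (x_{n-1}, x_n). *)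
Definition associated_system (X : Type) (f : X -> X -> X) (s : X * X) : X * X :=
  (s.2, f s.2 s.1).

Definition equations_conjugate (X Y : topologicalType)
    (f : X -> X -> X) (g : Y -> Y -> Y) : Prop :=
  @topologically_conjugate (X * X)%type (Y * Y)%type
    (associated_system f) (associated_system g).

Definition stable_under (T : Type) (D : set T) (f : T -> T -> T) : Prop :=
  forall x y, D x -> D y -> D (f x y).

Definition restrict_equation (T : Type) (D : set T) (f : T -> T -> T)
    (Df : stable_under D f) (x y : D) : D :=
  SigSub (mem_set (Df _ _ (set_valP x) (set_valP y))).

(* The existential asserts that g maps (0, oo)^2 into (0, oo), i.e. that the
   equation makes sense on (0, oo); this subtype has the subspace topology. *)
Definition conjugate_to_positive_equation (R : realType)
    (f g : R -> R -> R) : Prop :=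
  exists Dg : stable_under [set x : R | 0 < x] g,
    @equations_conjugate R [set x : R | 0 < x] f (restrict_equation Dg).

(* Main.v *)
(* The substitution z = exp (k (y - p)) is a homeomorphism from R onto
   (0, oo). When k alpha > 0 it turns |y| + y = 2 max(y, 0), scaled by k alpha,
   into a maximum of exponentials, and (L) into the max-type equation. The first
   claim takes k = ln A / q. Writing s = alpha + beta + gamma - 1, the factor
   exp (k (p s + delta)) disappears for p = - delta / s when s <> 0, and
   k = ln B * s / (2 alpha delta) then makes the threshold equal to B; when
   s = 0, p = 0 makes the threshold 1 and k = ln B / delta the factor B. *)
Require Import Defs.
From HB Require Import structures.
From mathcomp Require Import all_boot all_order all_algebra.
From mathcomp Require Import all_classical all_reals all_analysis.
From mathcomp Require Import ring lra.

Set Implicit Arguments.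
Unset Strict Implicit.
Unset Printing Implicit Defensive.

Import Order.TTheory GRing.Theory Num.Theory.
Import numFieldNormedType.Exports.

Local Open Scope ring_scope.

Lemma homeomorphism_square (X Y : topologicalType) (h : X -> Y) :
  homeomorphism h ->
  @homeomorphism (X * X)%type (Y * Y)%type (fun s => (h s.1, h s.2)).
Proof.
have cts (U V : topologicalType) (u : U -> V) : continuous u ->
    continuous (fun s : U * U => (u s.1, u s.2)).
  move=> cu s; apply: cvg_pair => /=.
    by apply: (@continuous_comp _ _ _ fst u); [exact: cvg_fst | exact: cu].
  by apply: (@continuous_comp _ _ _ snd u); [exact: cvg_snd | exact: cu].
move=> [ch [g [hK gK cg]]]; split; first exact: cts.
exists (fun s => (g s.1, g s.2)); split; last exact: cts.
- by move=> [x y] /=; rewrite !hK.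
- by move=> [x y] /=; rewrite !gK.
Qed.

Lemma associated_system_continuous (X : topologicalType) (f : X -> X -> X) :
  continuous (fun s : X * X => f s.1 s.2) -> continuous (associated_system f).
Proof.
move=> cf s; apply: cvg_pair => /=; first exact: cvg_snd.
apply: (@continuous_comp _ _ _ (fun s : X * X => (s.2, s.1))
  (fun s : X * X => f s.1 s.2)); last exact: cf.
by apply: cvg_pair; [exact: cvg_snd | exact: cvg_fst].
Qed.

(** Continuity of [psi] comes for free, since [psi] is [phi] conjugated by [h] and its continuous
    inverse. So the max-type system on the positive half-line never needs a continuity proof of its
    own. *)
Lemma homeomorphism_conjugate (X Y : topologicalType) (h : X -> Y)
    (phi : X -> X) (psi : Y -> Y) :
  homeomorphism h -> continuous phi -> h \o phi = psi \o h ->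
  topologically_conjugate phi psi.
Proof.
move=> hh cphi hE; have [ch [g [_ gK cg]]] := hh.
split=> //; last by exists h.
have -> : psi = h \o phi \o g by apply/funext => y; rewrite hE /= gK.
move=> y; apply: continuous_comp; first exact: cg.
by apply: continuous_comp; [exact: cphi | exact: ch].
Qed.

Lemma equations_conjugate_morph (X Y : topologicalType) (h : X -> Y)
    (f : X -> X -> X) (g : Y -> Y -> Y) :
  homeomorphism h -> continuous (fun s : X * X => f s.1 s.2) ->
  {morph h : x y / f x y >-> g x y} -> equations_conjugate f g.
Proof.
move=> hh cf hfg.
apply: (homeomorphism_conjugate (homeomorphism_square hh)).
  exact: associated_system_continuous.
by apply/funext => s; rewrite /associated_system /= hfg.
Qed.

Definition exp_positive (R : realType) (k p y : R) : [set x : R | 0 < x]%classic :=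
  SigSub (mem_set (expR_gt0 (k * (y - p)) : [set x : R | 0 < x]%classic (expR (k * (y - p))))).

Lemma exp_positive_homeomorphism (R : realType) (k p : R) : k != 0 ->
  homeomorphism (exp_positive k p).
Proof.
move=> k0; split.
  (* The subtype carries the initial topology of its inclusion into [R], so continuity is tested
     after that inclusion. *)
  apply: continuous_comp_initial => y /=.
  apply: (@continuous_comp _ _ _ (fun y => k * (y - p)) expR).
    by apply: cvgM; [exact: cvg_cst | apply: cvgB; [exact: cvg_id | exact: cvg_cst]].
  exact: continuous_expR.
exists (fun z => k^-1 * ln (\val z) + p); split.
- by move=> y /=; rewrite expRK mulKf// subrK.
- move=> [z z0]; apply: val_inj => /=; rewrite addrK mulVKf// lnK//.
  by move/set_mem: z0.
- move=> z.
  apply: (@continuous_comp _ _ _ set_val (fun x : R => k^-1 * ln x + p)).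
    exact: initial_continuous.
  apply: cvgD; last exact: cvg_cst.
  apply: cvgM; first exact: cvg_cst.
  (* [ln] is continuous at positive points, and membership in the subtype supplies positivity. *)
  exact/continuous_ln/(set_valP z).
Qed.

(** Every positive real is some [expR (k * (y - p))], so the identity on exponentials determines [g]
    on all positive pairs. It yields both the stability of the half-line and the morphism
    property. *)
Lemma conjugate_to_positive_equation_exp (R : realType) (k p : R)
    (f g : R -> R -> R) : k != 0 ->
  continuous (fun s : R * R => f s.1 s.2) ->
  (forall y y', g (expR (k * (y - p))) (expR (k * (y' - p))) =
                expR (k * (f y y' - p))) ->
  conjugate_to_positive_equation f g.
Proof.
move=> k0 cf fg.
have [_ [e [_ eK _]]] := exp_positive_homeomorphism p k0.
have eE (z : [set x : R | 0 < x]%classic) : \val z = expR (k * (e z - p)).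
  by rewrite -{1}(eK z).
have Dg : stable_under [set x : R | 0 < x]%classic g.
  move=> x y x0 y0 /=.
  have /= -> := eE (SigSub (mem_set x0)); have /= -> := eE (SigSub (mem_set y0)).
  by rewrite fg expR_gt0.
exists Dg.
apply: (equations_conjugate_morph (exp_positive_homeomorphism p k0) cf).
by move=> x y; apply: val_inj => /=; rewrite fg.
Qed.

Lemma abs_linear_continuous (R : realType) (alpha beta gamma delta : R) :
  continuous (fun s : R * R =>
    alpha * `|s.1| + beta * s.1 + gamma * s.2 + delta).
Proof.
move=> s; apply: cvgD; last exact: cvg_cst.
apply: cvgD; last by apply: cvgM; [exact: cvg_cst | exact: cvg_snd].
apply: cvgD; last by apply: cvgM; [exact: cvg_cst | exact: cvg_fst].
by apply: cvgM; [exact: cvg_cst | apply: cvg_norm; exact: cvg_fst].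
Qed.

(** Common source of all five claims: each picks [k] and [p], then matches its threshold and factor
    with the two exponentials here. *)
Lemma abs_linear_conjugate_max (R : realType)
    (alpha beta gamma delta k p : R) (g : R -> R -> R) :
  0 < k * alpha ->
  (forall z z', 0 < z -> 0 < z' ->
    g z z' = Num.max (z `^ (2 * alpha)) (expR (- (2 * (k * alpha) * p)))
      / (z `^ (alpha - beta) * z' `^ (- gamma))
      * expR (k * (p * (alpha + beta + gamma - 1) + delta))) ->
  conjugate_to_positive_equation
    (fun y y' => alpha * `|y| + beta * y + gamma * y' + delta) g.
Proof.
move=> ka gE.
have k0 : k != 0 by apply: contraTneq ka => ->; rewrite mul0r ltxx.
apply: (@conjugate_to_positive_equation_exp _ k p) => //.
  exact: abs_linear_continuous.
(* Positive bases avoid the special value of the power at base 0, so each power is an exponential of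
   a logarithm. *)
move=> y y'; rewrite gE ?expR_gt0// /powR !gt_eqF ?expR_gt0// !expRK.
(* The two exponents differ by [2 * k * alpha * y]; as [k * alpha] is positive, the sign of [y]
   decides the maximum. *)
have -> : Num.max (expR (2 * alpha * (k * (y - p))))
                  (expR (- (2 * (k * alpha) * p))) =
          expR (k * alpha * (`|y| + y - 2 * p)).
  case: (leP 0 y) => y0.
    rewrite ger0_norm// max_l ?ler_expR; last nra.
    by congr expR; ring.
  rewrite ltr0_norm// max_r ?ler_expR; last nra.
  by congr expR; ring.
by rewrite -expRD -expRN -!expRD; congr expR; ring.
Qed.

Theorem proposition2 (R : realType) (alpha beta gamma delta : R)
    (alpha_neq0 : alpha != 0) (delta_neq0 : delta != 0) :
  let L := fun y y' : R => alpha * `|y| + beta * y + gamma * y' + delta in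
  [/\ forall q A : R, q != 0 ->
        (1 < A /\ 0 < alpha / q) \/ (0 < A < 1 /\ alpha / q < 0) ->
        forall p : R,
          conjugate_to_positive_equation L (fun z z' : R =>
            Num.max (z `^ (2 * alpha)) (A `^ (- 2 * alpha * p / q))
              / (z `^ (alpha - beta) * z' `^ (- gamma))
              * A `^ ((p * (alpha + beta + gamma - 1) + delta) / q)),
      alpha + beta + gamma - 1 != 0 ->
        (0 < delta / (alpha + beta + gamma - 1) ->
           forall B : R, 1 < B ->
             conjugate_to_positive_equation L (fun z z' : R =>
               Num.max (z `^ (2 * alpha)) B
                 / (z `^ (alpha - beta) * z' `^ (- gamma)))) /\
        (delta / (alpha + beta + gamma - 1) < 0 ->
           forall C : R, 0 < C < 1 ->
             conjugate_to_positive_equation L (fun z z' : R =>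
               Num.max (z `^ (2 * alpha)) C
                 / (z `^ (alpha - beta) * z' `^ (- gamma))))
    & alpha + beta + gamma - 1 = 0 ->
        (0 < delta / alpha ->
           forall B : R, 1 < B ->
             conjugate_to_positive_equation L (fun z z' : R =>
               Num.max (z `^ (2 * alpha)) 1
                 / (z `^ (alpha - beta) * z' `^ (- gamma)) * B)) /\
        (delta / alpha < 0 ->
           forall C : R, 0 < C < 1 ->
             conjugate_to_positive_equation L (fun z z' : R =>
               Num.max (z `^ (2 * alpha)) 1
                 / (z `^ (alpha - beta) * z' `^ (- gamma)) * C))].
Proof.
move=> L; split.
- move=> q A q0 hA p.
  have A0 : 0 < A by case: hA => [[A1 _]|[/andP[]]//]; lra.
  apply: (@abs_linear_conjugate_max _ _ _ _ _ (ln A / q) p).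
    (* Regrouped as [ln A * (alpha / q)]: both alternatives of [hA] say that these two factors have
       the same sign. *)
    rewrite mulrAC -mulrA.
    case: hA => [[A1 aq]|[/andP[_ A1] aq]].
      by rewrite mulr_gt0// ln_gt0.
    by rewrite nmulr_rgt0// ln_lt0// A0.
  move=> z z' z0 z'0; rewrite /powR (gt_eqF A0).
  by congr (Num.max _ (expR _) / _ * expR _); field.
- set s := alpha + beta + gamma - 1 => s0.
  (* A sign condition on the product treats [1 < B] and [0 < C < 1] together. *)
  have key B : 0 < B -> 0 < ln B * (delta / s) ->
      conjugate_to_positive_equation L (fun z z' : R =>
        Num.max (z `^ (2 * alpha)) B
          / (z `^ (alpha - beta) * z' `^ (- gamma))).
    move=> B0 lB.
    apply: (@abs_linear_conjugate_max _ _ _ _ _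
      (ln B * s / (2 * alpha * delta)) (- (delta / s))).
      (* Factoring out half of a nonzero square shows that [k * alpha] has the sign of
         [ln B * (delta / s)]. *)
      have -> : ln B * s / (2 * alpha * delta) * alpha =
        ln B * (delta / s) * ((s / delta) ^+ 2 / 2) by field; rewrite ?s0 ?alpha_neq0 ?delta_neq0.
      by rewrite mulr_gt0// divr_gt0// exprn_even_gt0// mulf_neq0// invr_neq0.
    move=> z z' z0 z'0; rewrite -/s.
    have -> : - (2 * (ln B * s / (2 * alpha * delta) * alpha) * - (delta / s))
      = ln B by field; rewrite ?s0 ?alpha_neq0 ?delta_neq0.
    by rewrite mulNr divfK// addNr mulr0 expR0 mulr1 lnK.
  split=> [ds B B1|ds C /andP[C0 C1]]; apply: key => //.
  + by lra.
  + by rewrite mulr_gt0// ln_gt0.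
  + by rewrite nmulr_rgt0// ln_lt0// C0.
- move=> s0.
  have key B : 0 < B -> 0 < ln B * (delta / alpha) ->
      conjugate_to_positive_equation L (fun z z' : R =>
        Num.max (z `^ (2 * alpha)) 1
          / (z `^ (alpha - beta) * z' `^ (- gamma)) * B).
    move=> B0 lB.
    apply: (@abs_linear_conjugate_max _ _ _ _ _ (ln B / delta) 0).
      (* Again a nonzero square is split off, leaving the product that [lB] assumes positive. *)
      have -> : ln B / delta * alpha =
        ln B * (delta / alpha) * (alpha / delta) ^+ 2 by field; rewrite ?s0 ?alpha_neq0 ?delta_neq0.
      by rewrite mulr_gt0// exprn_even_gt0// mulf_neq0// invr_neq0.
    by move=> z z' z0 z'0; rewrite mulr0 oppr0 expR0 mul0r add0r divfK// lnK.
  split=> [ds B B1|ds C /andP[C0 C1]]; apply: key => //.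
  + by lra.
  + by rewrite mulr_gt0// ln_gt0.
  + by rewrite nmulr_rgt0// ln_lt0// C0.
Qed.
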